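(* Let $\mathcal H'$ be a family of simple graphs and let $\mathcal H$ be the family of loop graphs obtained from those of $\mathcal H'$ by adding a loop to each vertex. Let $\ell\ge 2$ be an integer. A simple graph $G$ is of $\mathcal H$-clique-width at most $\ell$ if and only if $G$ is isomorphic to an induced subgraph of the strong product $H'\boxtimes M$, where $H'\in\mathcal H'$ and $M$ is a simple graph of clique-width at most $\ell$.
   Context: All graphs are finite. Simple graphs have no loops and no parallel edges. A loop graph has no parallel edges, but may have at most one loop per vertex. The strong product $G_1\boxtimes G_2$ of simple graphs has vertex set $V(G_1)\times V(G_2)$, and $[u,u'],[v,v']$ are adjacent iff ($uv\in E(G_1)$ and $u'v'\in E(G_2)$) or ($u=v$ and $u'v'\in E(G_2)$) or ($uv\in E(G_1)$ and $u'=v'$). Clique-width of a simple graph: the least $\ell$ such that the graph (irrespective of labels) is the value of an $\ell$-expression built with the operations: create a new vertex of label $i\in\{1,\dots,\ell\}$; disjoint union of two labelled graphs; for $i\ne j$, add all missing edges between vertices of label $i$ and vertices of label $j$; for $i\neq j$, relabel all vertices of label $i$ to label $j$. $\mathcal H$-clique-width: let $\mathcal H$ be a family of loop graphs, $H\in\mathcal H$, $\ell>0$ an integer. An $(H,\ell)$-expression is an algebraic expression on graphs whose vertices carry labels $(i,v)$ with $i\in\{1,\dots,\ell\}$ (the colour) and $v\in V(H)$ (the parameter vertex), using the operations: create a new vertex with a single label $(i,v)$; disjoint union of two labelled graphs; for $1\le i\ne j\le\ell$, add all edges between the vertices of label $(i,v)$ and the vertices of label $(j,w)$ over all pairs $(v,w)\in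 V(H)\times V(H)$ with $vw\in E(H)$ (including $v=w$ when $v$ has a loop in $H$); for $1\le i\neq j\le\ell$, recolour $i$ to $j$, i.e. relabel every vertex with label $(i,v)$, $v\in V(H)$, to $(j,v)$. The $\mathcal H$-clique-width of a simple graph $G$ is the smallest $\ell$ such that (some labelling of) $G$ is the value of an $(H,\ell)$-expression for some $H\in\mathcal H$, and $\infty$ if there is no such $\ell$. *)

(* Defs.v *)
From HB Require Import structures.
From mathcomp Require Import all_boot.
From mathcomp Require Import boolp.
Set Implicit Arguments.
Unset Strict Implicit.
Unset Printing Implicit Defensive.

Record simple_graph := SimpleGraph {
  vertex :> finType;
  adj : rel vertex;
  adj_sym : symmetric adj;
  adj_irr : irreflexive adj }.

Record loop_graph := LoopGraph {
  loop_vertex :> finType;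
  loop_adj : rel loop_vertex;
  loop_adj_sym : symmetric loop_adj }.

Definition isomorphic (G H : simple_graph) : Prop :=
  exists2 f : G -> H, bijective f & forall x y, adj (f x) (f y) = adj x y.

Section Induced.
Variables (G : simple_graph) (A : {set G}).

Definition induced_adj : rel {x : G | x \in A} :=
  fun x y => adj (val x) (val y).

Lemma induced_adj_sym : symmetric induced_adj.
Proof. by move=> x y; apply: adj_sym. Qed.

Lemma induced_adj_irr : irreflexive induced_adj.
Proof. by move=> x; apply: adj_irr. Qed.

Definition induced_subgraph : simple_graph :=
  SimpleGraph induced_adj_sym induced_adj_irr.
End Induced.

Section AddLoops.
Variable G : simple_graph.

Definition add_loops_adj : rel G := fun x y => (x == y) || adj x y.

Lemma add_loops_adj_sym : symmetric add_loops_adj.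
Proof. by move=> x y; rewrite /add_loops_adj eq_sym adj_sym. Qed.

Definition add_loops : loop_graph := LoopGraph add_loops_adj_sym.
End AddLoops.

Definition add_loops_family (F : simple_graph -> Prop) : loop_graph -> Prop :=
  fun H => exists2 K, F K & H = add_loops K.

Section StrongProduct.
Variables G1 G2 : simple_graph.

Definition strong_adj : rel (G1 * G2)%type := fun p q =>
  [|| adj p.1 q.1 && adj p.2 q.2,
      (p.1 == q.1) && adj p.2 q.2
    | adj p.1 q.1 && (p.2 == q.2)].

Lemma strong_adj_sym : symmetric strong_adj.
Proof.
move=> p q; rewrite /strong_adj (adj_sym p.1) (adj_sym p.2).
by rewrite (eq_sym p.1) (eq_sym p.2).
Qed.

Lemma strong_adj_irr : irreflexive strong_adj.
Proof. by move=> p; rewrite /strong_adj !adj_irr !andbF. Qed.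

Definition strong_product : simple_graph :=
  SimpleGraph strong_adj_sym strong_adj_irr.
End StrongProduct.

Record labelled_graph (L : Type) := LabelledGraph {
  underlying :> simple_graph;
  label : underlying -> L }.

Section LabelledOperations.
Variable L : Type.

Definition single_adj : rel unit := fun _ _ => false.

Lemma single_adj_sym : symmetric single_adj.
Proof. by []. Qed.

Lemma single_adj_irr : irreflexive single_adj.
Proof. by []. Qed.

Definition single_vertex (a : L) : labelled_graph L :=
  @LabelledGraph L (SimpleGraph single_adj_sym single_adj_irr) (fun _ => a).

Section Union.
Variables G1 G2 : labelled_graph L.

Definition union_adj : rel (G1 + G2)%type := fun x y =>
  match x, y with
  | inl x1, inl y1 => adj x1 y1
  | inr x2, inr y2 => adj x2 y2
  | _, _ => false
  end.

Lemma union_adj_sym : symmetric union_adj.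
Proof. by move=> [x|x] [y|y] //=; apply: adj_sym. Qed.

Lemma union_adj_irr : irreflexive union_adj.
Proof. by move=> [x|x] /=; apply: adj_irr. Qed.

Definition disjoint_union : labelled_graph L :=
  @LabelledGraph L (SimpleGraph union_adj_sym union_adj_irr)
    (fun x => match x with inl x1 => label x1 | inr x2 => label x2 end).
End Union.

Section AddEdges.
Variables (r : rel L) (G : labelled_graph L).

(* In the expressions below, r relates only labels of distinct colours, so
   that the guard x != y is then redundant. *)
Definition add_edges_adj : rel G := fun x y =>
  adj x y ||
  (x != y) && (r (label x) (label y) || r (label y) (label x)).

Lemma add_edges_adj_sym : symmetric add_edges_adj.
Proof.
by move=> x y; rewrite /add_edges_adj adj_sym eq_sym (orbC (r _ _)).
Qed.

Lemma add_edges_adj_irr : irreflexive add_edges_adj.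
Proof. by move=> x; rewrite /add_edges_adj adj_irr eqxx. Qed.

Definition add_edges : labelled_graph L :=
  @LabelledGraph L (SimpleGraph add_edges_adj_sym add_edges_adj_irr)
    (@label L G).
End AddEdges.

Definition relabel (f : L -> L) (G : labelled_graph L) : labelled_graph L :=
  @LabelledGraph L G (fun x => f (label x)).
End LabelledOperations.

(* The colours 1, ..., l are encoded as 'I_l; there is no expression for
   l = 0, hence no need for a separate condition l > 0. *)
Inductive cw_expr (l : nat) : Type :=
| CwNew of 'I_l
| CwUnion of cw_expr l & cw_expr l
| CwJoin (i j : 'I_l) of i != j & cw_expr l
| CwRelabel (i j : 'I_l) of i != j & cw_expr l.

Fixpoint cw_value l (e : cw_expr l) : labelled_graph 'I_l :=
  match e with
  | CwNew i => single_vertex i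
  | CwUnion e1 e2 => disjoint_union (cw_value e1) (cw_value e2)
  | CwJoin i j _ e1 =>
      add_edges (fun a b => (a == i) && (b == j)) (cw_value e1)
  | CwRelabel i j _ e1 =>
      relabel (fun a => if a == i then j else a) (cw_value e1)
  end.

Inductive hcw_expr (H : loop_graph) (l : nat) : Type :=
| HcwNew of 'I_l & H
| HcwUnion of hcw_expr H l & hcw_expr H l
| HcwJoin (i j : 'I_l) of i != j & hcw_expr H l
| HcwRecolour (i j : 'I_l) of i != j & hcw_expr H l.

Fixpoint hcw_value (H : loop_graph) l (e : hcw_expr H l) :
    labelled_graph ('I_l * H) :=
  match e with
  | HcwNew i v => single_vertex (i, v)
  | HcwUnion e1 e2 => disjoint_union (hcw_value e1) (hcw_value e2)
  | HcwJoin i j _ e1 =>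
      add_edges (fun a b => [&& a.1 == i, b.1 == j & loop_adj a.2 b.2])
        (hcw_value e1)
  | HcwRecolour i j _ e1 =>
      relabel (fun a => if a.1 == i then (j, a.2) else a) (hcw_value e1)
  end.

(* Values in the naturals extended by infinity: None stands for infinity. *)
Definition least (P : nat -> Prop) : option nat :=
  if pselect (exists n, `[< P n >]) is left exP then Some (ex_minn exP)
  else None.

Definition at_most (w : option nat) (l : nat) : bool :=
  if w is Some k then k <= l else false.

Definition clique_width (G : simple_graph) : option nat :=
  least (fun l => exists e : cw_expr l, isomorphic G (cw_value e)).

Definition hclique_width (F : loop_graph -> Prop) (G : simple_graph) :
    option nat :=
  least (fun l => exists2 H, F H &
                  exists e : hcw_expr H l, isomorphic G (hcw_value e)).

(* Main.v *)
(* If every vertex of [K] gets a loop, an [(add_loops K, l)]-expression and the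
   clique-width expression obtained by forgetting parameters satisfy: two
   vertices are adjacent in the first value iff they are adjacent in the second
   value and their parameters are equal or adjacent.  So sending [x] to
   (parameter of [x], [x]) is an induced embedding into a strong product.
   Conversely, in an expression of [M] replace each creation of a vertex of
   colour [i] by a copy of (the needed part of) [K], all of whose vertices end
   with colour [i]; a second colour is needed to build this copy. *)
Require Import Defs.
From HB Require Import structures.
From mathcomp Require Import all_boot.
From mathcomp Require Import boolp.
Set Implicit Arguments.
Unset Strict Implicit.
Unset Printing Implicit Defensive.

(** * Widths as least values; induced subgraphs as embeddings *)

Lemma at_most_leastP (P : nat -> Prop) (l : nat) :
  at_most (least P) l <-> exists2 k, k <= l & P k.
Proof.
rewrite /least; case: pselect => [exP|nexP] /=; last first.
  by split=> // -[k _ Pk]; case: nexP; exists k; apply/asboolP.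
case: ex_minnP => m /asboolP Pm min_m; split=> [le_ml|[k le_kl Pk]].
  by exists m.
by apply: leq_trans le_kl; apply: min_m; apply/asboolP.
Qed.

Lemma isomorphic_refl (G : simple_graph) : isomorphic G G.
Proof. by exists id => //; exists id. Qed.

(** Both graphs are copies of [r] on the common image; choosing preimages in each direction gives
    mutually inverse maps. *)
Lemma isomorphic_same_image (T : Type) (r : rel T) (G1 G2 : simple_graph)
    (f1 : G1 -> T) (f2 : G2 -> T) :
  injective f1 -> injective f2 ->
  (forall t, (exists x, f1 x = t) <-> (exists y, f2 y = t)) ->
  (forall x y, adj x y = r (f1 x) (f1 y)) ->
  (forall x y, adj x y = r (f2 x) (f2 y)) ->
  isomorphic G1 G2.
Proof.
move=> inj1 inj2 im12 adj1 adj2.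
have /choice[g gE] x : exists y, f2 y = f1 x by apply/im12; exists x.
have /choice[h hE] y : exists x, f1 x = f2 y by apply/im12; exists y.
exists g => [|x y]; last by rewrite adj2 !gE adj1.
by exists h => x; [apply: inj1; rewrite hE gE|apply: inj2; rewrite gE hE].
Qed.

Lemma isomorphic_inducedP (G P : simple_graph) :
  (exists A : {set P}, isomorphic G (induced_subgraph A)) <->
  (exists2 f : G -> P, injective f & forall x y, adj (f x) (f y) = adj x y).
Proof.
split=> [[A [f bij_f adj_f]]|[f inj_f adj_f]].
  exists (val \o f) => [|x y]; last by rewrite -adj_f.
  exact: inj_comp val_inj (bij_inj bij_f).
exists [set y in codom f].
apply: (@isomorphic_same_image P (@adj P) G (induced_subgraph _) f val) => //.
- exact: val_inj.
- move=> t; split=> [[x <-]|[[y] /= + <-]].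
    have fxP : f x \in [set y in codom f] by rewrite inE codom_f.
    by exists (exist _ (f x) fxP).
  by rewrite inE => /codomP[x ->]; exists x.
Qed.

(** Separates edges between copies of [K], governed by looped adjacency, from edges inside one
    copy. *)
Lemma strong_adjE (K M : simple_graph) (p q : K * M) :
  strong_adj p q =
  adj p.2 q.2 && add_loops_adj p.1 q.1 || (p.2 == q.2) && adj p.1 q.1.
Proof.
rewrite /strong_adj /add_loops_adj.
by case: (p.1 == q.1); case: (p.2 == q.2); case: (adj p.1 q.1);
   case: (adj p.2 q.2).
Qed.

(** * Forgetting parameters *)

Fixpoint forget_parameters (H : loop_graph) l (e : hcw_expr H l) : cw_expr l :=
  match e with
  | HcwNew i _ => CwNew i
  | HcwUnion e1 e2 => CwUnion (forget_parameters e1) (forget_parameters e2)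
  | HcwJoin i j ij e1 => CwJoin ij (forget_parameters e1)
  | HcwRecolour i j ij e1 => CwRelabel ij (forget_parameters e1)
  end.

(** Parameters never change, and every join tests the same symmetric relation on them, so this test
    factors out of the whole expression. *)
Lemma forget_parametersP (H : loop_graph) l (e : hcw_expr H l) :
  exists f : hcw_value e -> cw_value (forget_parameters e),
    [/\ injective f, forall x, label (f x) = (label x).1 &
        forall x y, adj x y =
          adj (f x) (f y) && loop_adj (label x).2 (label y).2].
Proof.
elim: e => [i v|e1 [f1 [inj1 lab1 adj1]] e2 [f2 [inj2 lab2 adj2]]
           |i j ij e [f [inj_f lab_f adj_f]]|i j ij e [f [inj_f lab_f adj_f]]]
           /=.
- by exists id; split.
- exists (fun x => match x with inl x1 => inl (f1 x1) | inr x2 => inr (f2 x2) end).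
  split=> [[x|x] [y|y] //=|[x|x] //=|[x|x] [y|y] //=].
  + by case=> /inj1->.
  + by case=> /inj2->.
- exists f; split=> //= x y; rewrite /add_edges_adj adj_f !lab_f (inj_eq inj_f).
  rewrite (loop_adj_sym (label y).2).
  by case: (adj _ _); case: (x != y); case: (_ == i); case: (_ == j);
    case: (_ == i); case: (_ == j); case: (loop_adj _ _).
- exists f; split=> //= x; first by rewrite lab_f; case: ifP.
  by move=> y; rewrite adj_f; do 2![case: ifP => _].
Qed.

(** * Expressions for labelled graphs on a subset of a given type *)

(** The vertex type of a value depends on the expression; a fixed ambient type [T] lets values of
    different expressions be compared. Only the restrictions of [r] and [c] to [A] matter. *)
Definition represents (H : loop_graph) l (e : hcw_expr H l) (T : Type)
    (A : T -> Prop) (r : rel T) (c : T -> 'I_l * H) : Prop :=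
  exists f : hcw_value e -> T,
    [/\ injective f, forall t, A t <-> exists x, f x = t,
        forall x, label x = c (f x) & forall x y, adj x y = r (f x) (f y)].

Section Represents.
Variables (H : loop_graph) (l : nat).
Implicit Types (e : hcw_expr H l) (T : Type).

Lemma represents_map e T T' (g : T -> T') (A : T -> Prop) (A' : T' -> Prop)
    r r' c c' :
  injective g -> (forall t', A' t' <-> exists2 t, A t & g t = t') ->
  (forall s t, A s -> A t -> r' (g s) (g t) = r s t) ->
  (forall t, A t -> c' (g t) = c t) ->
  represents e A r c -> represents e A' r' c'.
Proof.
move=> inj_g A'E rE cE [f [inj_f AE lab_f adj_f]].
have Af x : A (f x) by apply/AE; exists x.
exists (g \o f); split=> [|t'|x|x y] /=.
- exact: inj_comp.
- rewrite A'E; split=> [[t /AE[x <-] <-]|[x <-]]; first by exists x.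
  by exists (f x).
- by rewrite cE.
- by rewrite rE.
Qed.

Lemma represents_ext e T (A A' : T -> Prop) r r' c c' :
  (forall t, A' t <-> A t) ->
  (forall s t, A s -> A t -> r' s t = r s t) ->
  (forall t, A t -> c' t = c t) ->
  represents e A r c -> represents e A' r' c'.
Proof.
move=> A'E; apply: (@represents_map e T T id) => // t.
by rewrite A'E; split=> [At|[s As <-] //]; exists t.
Qed.

Lemma represents_new T (t : T) (r : rel T) (c : T -> 'I_l * H) :
  ~~ r t t -> represents (HcwNew (c t).1 (c t).2) (eq t) r c.
Proof.
move=> /negbTE rtt; exists (fun=> t); split=> [[] [] //|u|_|_ _] //=.
- by split=> [<-|[]//]; exists tt.
- by case: (c t).
Qed.

Lemma represents_union e1 e2 T (A1 A2 : T -> Prop) (r : rel T) c :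
  (forall t, A1 t -> A2 t -> False) ->
  (forall s t, A1 s -> A2 t -> r s t = false /\ r t s = false) ->
  represents e1 A1 r c -> represents e2 A2 r c ->
  represents (HcwUnion e1 e2) (fun t => A1 t \/ A2 t) r c.
Proof.
move=> A12 r12 [f1 [inj1 AE1 lab1 adj1]] [f2 [inj2 AE2 lab2 adj2]].
have Af1 x : A1 (f1 x) by apply/AE1; exists x.
have Af2 x : A2 (f2 x) by apply/AE2; exists x.
exists (fun x => match x with inl x1 => f1 x1 | inr x2 => f2 x2 end).
split=> [[x|x] [y|y] /= fxy|t|[x|x] //=|[x|x] [y|y] //=].
- by rewrite (inj1 _ _ fxy).
- by case: (A12 (f1 x)) => //; rewrite fxy.
- by case: (A12 (f1 y)) => //; rewrite -fxy.
- by rewrite (inj2 _ _ fxy).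
- split=> [[/AE1[x <-]|/AE2[x <-]]|[[x|x] <-]]; [ | |by left|by right].
    by exists (inl x).
  by exists (inr x).
- by case: (r12 (f1 x) (f2 y)).
- by case: (r12 (f1 y) (f2 x)).
Qed.

Lemma represents_join (i j : 'I_l) (ij : i != j) e T (A : T -> Prop)
    (r : rel T) c :
  represents e A r c ->
  represents (HcwJoin ij e) A
    (fun s t => [|| r s t,
      [&& (c s).1 == i, (c t).1 == j & loop_adj (c s).2 (c t).2] |
      [&& (c t).1 == i, (c s).1 == j & loop_adj (c t).2 (c s).2]]) c.
Proof.
move=> [f [inj_f AE lab_f adj_f]]; exists f; split=> //= x y.
rewrite /add_edges_adj adj_f !lab_f.
(* The target relation lacks the guard [x != y]; on the diagonal its new terms vanish because one
   colour cannot equal both [i] and [j]. *)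
have [->|//] := eqVneq x y; congr (_ || _).
by have [->|] := eqVneq (c (f y)).1 i; rewrite // (negbTE ij).
Qed.

Lemma represents_recolour (i j : 'I_l) (ij : i != j) e T (A : T -> Prop)
    (r : rel T) c :
  represents e A r c ->
  represents (HcwRecolour ij e) A r
    (fun t => if (c t).1 == i then (j, (c t).2) else c t).
Proof.
move=> [f [inj_f AE lab_f adj_f]]; exists f; split=> //= x.
by rewrite lab_f.
Qed.

End Represents.

(** * Replacing vertices by copies of parts of [K] *)

Section Backward.
Variables (K : simple_graph) (l : nat).
Hypothesis l_ge2 : 1 < l.

(** Vertices are added one at a time: the new one gets an auxiliary colour [j], is joined to colour
    [i], which creates exactly its edges in [K], and is then recoloured to [i]. The form [v :: s]
    excludes the empty graph, which has no expression. *)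
Lemma monochromatic_expr (i : 'I_l) (v : K) (s : seq K) :
  uniq (v :: s) ->
  exists e : hcw_expr (add_loops K) l,
    represents e (fun u => u \in v :: s) (@adj K) (fun u => (i, u)).
Proof.
have [j ji] : exists j : 'I_l, j != i.
  have l_gt0 : 0 < l by apply: leq_trans l_ge2.
  case: (eqVneq (Ordinal l_gt0) i) => [<-|ne_0i].
    by exists (Ordinal l_ge2).
  by exists (Ordinal l_gt0).
elim: s v => [|w s IHs] v /=.
  move=> _; exists (HcwNew i (v : add_loops K)).
  apply: represents_ext (@represents_new _ _ K v (@adj K)
    (fun u => (i, u : add_loops K)) _) => // [t|].
    by rewrite inE; split=> [/eqP|->].
  by rewrite adj_irr.
case/andP=> vNws uniq_ws; have [e eP] := IHs w uniq_ws.
(* [c] and [r] describe the stage just before the join: [v] is still isolated and alone in colour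
   [j]. *)
pose c u : 'I_l * add_loops K := (if u == v then j else i, u).
pose r : rel K := fun x y => [&& x != v, y != v & adj x y].
have newP : represents (HcwNew (c v).1 (c v).2) (eq v) r c.
  by apply: represents_new; rewrite /r eqxx.
have neq_v u : u \in w :: s -> u != v.
  by move=> u_ws; apply: contraNneq vNws => <-.
have {}eP : represents e (fun u => u \in w :: s) r c.
  apply: represents_ext eP => // [x y xP yP|x xP].
    by rewrite /r !neq_v.
  by rewrite /c (negbTE (neq_v _ xP)).
have {newP}eP : represents (HcwUnion (HcwNew (c v).1 (c v).2) e)
    (fun u => v = u \/ u \in w :: s) r c.
  apply: represents_union newP eP => [t <- tP|x y <- yP].
    by have := neq_v _ tP; rewrite eqxx.
  by rewrite /r eqxx andbF.
have {}eP := represents_recolour ji (represents_join ji eP).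
eexists; apply: represents_ext eP.
- by move=> t; rewrite inE; split=> [/orP[/eqP->|]|[->|->]];
    rewrite ?eqxx ?orbT //; [left|right].
- move=> x y _ _; rewrite /r /c /= /add_loops_adj (adj_sym y) (eq_sym y x).
  have ij : (i == j) = false by rewrite eq_sym (negbTE ji).
  have [->|xv] := eqVneq x v; have [->|yv] := eqVneq y v;
    rewrite ?eqxx ?ij ?(negbTE ji) ?adj_irr ?andbF ?orbF //=.
  by rewrite (negbTE xv).
- by move=> t _; rewrite /c /=; case: (t == v); rewrite ?eqxx //= eq_sym (negbTE ji).
Qed.

(** Colours are widened from [k] to [l] because building a copy of [K] takes two colours even when
    [k] is 1. *)
Definition product_label k (le_kl : k <= l) (M : labelled_graph 'I_k)
  (p : K * M) : 'I_l * add_loops K := (widen_ord le_kl (label p.2), p.1).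

(** The set [A] is general because expressions cannot delete vertices: each copy of [K] must contain
    only the needed parameters from its creation on. *)
Lemma blow_up_expr k (le_kl : k <= l) (e : cw_expr k)
    (A : K * cw_value e -> Prop) :
  (exists p, A p) ->
  exists e' : hcw_expr (add_loops K) l,
    represents e' A (@strong_adj K (cw_value e))
      (@product_label _ le_kl (cw_value e)).
Proof.
elim: e A => [i|e1 IH1 e2 IH2|i j ij e IHe|i j ij e IHe] /= A exA.
- pose s := enum [pred u | `[<A (u, tt)>]].
  have sE u : u \in s <-> A (u, tt).
    by rewrite mem_enum inE; split=> [/asboolP|/asboolP].
  case s_eq: s (enum_uniq [pred u | `[<A (u, tt)>]]) => [|v s'];
    rewrite -/s s_eq.
    by case: exA => -[u []] /sE; rewrite s_eq.
  move=> /(monochromatic_expr (widen_ord le_kl i))[e' e'P]; exists e'.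
  apply: (@represents_map _ _ _ K (K * unit)%type (fun u => (u, tt))) e'P.
  + by move=> u1 u2 [].
  + move=> [u []]; rewrite -sE s_eq; split=> [us|[u' u's [<-]] //].
    by exists u.
  + by move=> u1 u2 _ _; rewrite strong_adjE.
  + by [].
- pose A1 p := A (p.1, inl p.2); pose A2 p := A (p.1, inr p.2).
  pose B1 (p : K * (cw_value e1 + cw_value e2)) := exists2 q, A1 q & (q.1, inl q.2) = p.
  pose B2 (p : K * (cw_value e1 + cw_value e2)) := exists2 q, A2 q & (q.1, inr q.2) = p.
  have AE p : A p <-> B1 p \/ B2 p.
    split=> [|[[q Aq <-]|[q Aq <-]] //].
    by case: p => u [x|x] Ap; [left|right]; exists (u, x).
  have lift1 e' : represents e' A1 (@strong_adj K (cw_value e1))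
      (@product_label _ le_kl (cw_value e1)) ->
      represents e' B1 (@strong_adj K (cw_value (CwUnion e1 e2)))
      (@product_label _ le_kl (cw_value (CwUnion e1 e2))).
    apply: (@represents_map _ _ _ _ _
      (fun q : K * cw_value e1 => (q.1, inl q.2))) => //.
    by move=> [u x] [v y] /= [-> ->].
  have lift2 e' : represents e' A2 (@strong_adj K (cw_value e2))
      (@product_label _ le_kl (cw_value e2)) ->
      represents e' B2 (@strong_adj K (cw_value (CwUnion e1 e2)))
      (@product_label _ le_kl (cw_value (CwUnion e1 e2))).
    apply: (@represents_map _ _ _ _ _
      (fun q : K * cw_value e2 => (q.1, inr q.2))) => //.
    by move=> [u x] [v y] /= [-> ->].
  (* If [A] misses one side of the union, that operand is dropped, since nothing represents an empty
     set. *)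
  have [exA1|nA1] := pselect (exists p, A1 p); last first.
    have [|e' e'P] := IH2 A2.
      by case: exA => -[u [x|x]] Ap; [case: nA1|]; exists (u, x).
    exists e'; apply: represents_ext (lift2 _ e'P) => // p.
    by rewrite AE; split=> [[[q A1q _]|]|]; [case: nA1; exists q| |right].
  have [exA2|nA2] := pselect (exists p, A2 p); last first.
    have [e' e'P] := IH1 A1 exA1.
    exists e'; apply: represents_ext (lift1 _ e'P) => // p.
    by rewrite AE; split=> [[|[q A2q _]]|]; [|case: nA2; exists q|left].
  have [e1' /lift1 e1'P] := IH1 A1 exA1; have [e2' /lift2 e2'P] := IH2 A2 exA2.
  exists (HcwUnion e1' e2').
  apply: represents_ext (represents_union _ _ e1'P e2'P) => //.
    by move=> _ [p _ <-] [q _ []].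
  by move=> _ _ [p _ <-] [q _ <-]; rewrite !strong_adjE.
- have [e' e'P] := IHe A exA.
  have ij' : widen_ord le_kl i != widen_ord le_kl j by [].
  exists (HcwJoin ij' e'); apply: represents_ext (represents_join ij' e'P) => //.
  move=> p q _ _; rewrite !strong_adjE /= /add_edges_adj.
  have -> : add_loops_adj q.1 p.1 = add_loops_adj p.1 q.1.
    exact: add_loops_adj_sym.
  rewrite -!val_eqE /= !val_eqE.
  (* Two vertices of the same copy share a colour, so the join does not affect them. Between
     distinct copies it adds exactly looped adjacency in [K]. *)
  have [->|_] := eqVneq p.2 q.2.
    have [->|] := eqVneq (label q.2) i; rewrite ?orbF //.
    by rewrite (negbTE ij) /= !orbF.
  by case: (adj p.2 q.2); case: (add_loops_adj p.1 q.1);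
    rewrite ?andbT ?andbF ?orbF ?orbT.
- have [e' e'P] := IHe A exA.
  have ij' : widen_ord le_kl i != widen_ord le_kl j by [].
  exists (HcwRecolour ij' e').
  apply: represents_ext (represents_recolour ij' e'P) => // p _ /=.
  by rewrite /product_label -val_eqE /= val_eqE; case: ifP.
Qed.

End Backward.

(* The empty graph is not the value of any expression, but is an induced
   subgraph of every graph; hence G is assumed to have a vertex. *)
Theorem theorem1p1 (F : simple_graph -> Prop) (l : nat) (G : simple_graph)
    (l_ge2 : 2 <= l) (G_nonempty : 0 < #|G|) :
  at_most (hclique_width (add_loops_family F) G) l <->
  exists K M : simple_graph,
    [/\ F K, at_most (clique_width M) l &
        exists A : {set strong_product K M},
          isomorphic G (induced_subgraph A)].
Proof.
split=> [/at_most_leastP[k le_kl [_ [K FK ->] [e [g bij_g adj_g]]]]|].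
  have [f [inj_f _ adj_f]] := forget_parametersP e.
  exists K, (cw_value (forget_parameters e)); split=> //.
    apply/at_most_leastP; exists k => //.
    by exists (forget_parameters e); apply: isomorphic_refl.
  apply/isomorphic_inducedP.
  exists (fun x => ((label (g x)).2, f (g x))) => [x y [_ /inj_f]|x y].
    exact: bij_inj.
  rewrite -adj_g adj_f /= strong_adjE /= orbC.
  (* By injectivity of [f], two vertices in the same copy of [K] coincide, and irreflexivity kills
     that clause. *)
  by have [/inj_f->|//] := eqVneq (f (g x)) _; rewrite adj_irr.
move=> [K [M [FK /at_most_leastP[k le_kl [e [g bij_g adj_g]]]]]].
move=> /isomorphic_inducedP[h inj_h adj_h].
(* The embedding is moved from [M] to the value of its expression; its image is the set to be blown
   up. *)
pose h' x := ((h x).1, g (h x).2).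
have inj_h' : injective h'.
  move=> x y [eq1 /(bij_inj bij_g) eq2]; apply: inj_h.
  by case: (h x) (h y) eq1 eq2 => [? ?] [? ?] /= -> ->.
have [|e' [f [inj_f imf _ adj_f]]] :=
    blow_up_expr l_ge2 le_kl (A := fun p => exists x, h' x = p).
  by case/card_gt0P: G_nonempty => x _; exists (h' x), x.
(* The witness is [l] rather than [k], as the blown-up expression uses [l] colours. *)
apply/at_most_leastP; exists l => //; exists (add_loops K); first by exists K.
exists e'; apply: isomorphic_same_image inj_h' inj_f imf _ adj_f => x y.
rewrite -adj_h /= !strong_adjE /= adj_g.
by rewrite (inj_eq (bij_inj bij_g)).
Qed.
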